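(* Let $d \ge 1$ be an integer, let $\mathbf{n} \in \mathbb{Z}_{\ge 0}^d$ be an integer vector, and let $\mathcal{S}, \mathcal{R} \subseteq \mathbb{Z}_{\ge 0}^d$ be non-empty finite families of integer vectors. Suppose that for all $\mathbf{s} \in \mathcal{S}$, $\mathbf{r} \in \mathcal{R}$, and $i \in [d]$, we have $n_i \ge s_i$ and $r_i \ge s_i$. Define $$\downarrow \mathcal{S} := \{\mathbf{m} \in \mathbb{Z}_{\ge 0}^d \mid \exists \mathbf{s} \in \mathcal{S} \ \forall i \in [d]\ \ m_i \le s_i\},\qquad \mathcal{R}(\mathbf{n}) := \{\mathbf{r} \in \mathcal{R} \mid \forall i \in [d]\ \ r_i \le n_i\}.$$ Then $$\mathrm{c\text{-}wsat}(K^{\mathcal{S}}_{\mathbf{n}}, K^{\mathcal{S}}_{\mathcal{R}}) \ge \sum_{\mathbf{s} \in \mathcal{S}} \prod_{i \in [d]} \binom{n_i}{s_i} - q(\mathbf{n}, \mathcal{S}, \mathcal{R}),$$ where $$q(\mathbf{n}, \mathcal{S}, \mathcal{R}) = \sum_{\mathbf{m} \in \downarrow \mathcal{S}}\ \sum_{\emptyset \ne \mathcal{Q} \subseteq \mathcal{R}(\mathbf{n})} (-1)^{|\mathcal{Q}| + 1} \prod_{\substack{1\le i\le d \\ m_i \ne 0}} \binom{m_i - 1 + n_i - \max_{\mathbf{r} \in \mathcal{Q}} r_i}{m_i}.$$ Moreover, this bound is tight (i.e. equality holds) if at least one of the following holds: (1) there exists $\tilde{\mathbf{r}} \in \mathcal{R}$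 such that for all $\mathbf{r} \in \mathcal{R}$ and $i \in [d]$ we have $r_i \ge \tilde{r}_i$; (2) there exists $\tilde{\mathbf{s}} \in \mathcal{S}$ such that for all $\mathbf{s} \in \mathcal{S}$ and $i \in [d]$ we have $s_i \le \tilde{s}_i$.
   Context: Notation: for an integer $n\ge 1$, $[n]=\{1,\dots,n\}$, and $[n]=\emptyset$ for $n\le 0$. A hypergraph $G$ has a finite vertex set $V(G)$ and an edge set $E(G)$ which is a set of subsets of $V(G)$ (not necessarily uniform). Empty products equal $1$ and empty sums equal $0$. For $\mathbf{r}\in\mathbb{Z}_{\ge0}^d$ and a non-empty finite family $\mathcal{S}\subseteq\mathbb{Z}_{\ge0}^d$, the hypergraph $K^{\mathcal{S}}_{\mathbf{r}}$ has vertex set $\bigcup_{i\in[d]}[r_i]\times\{i\}$, and its edges are exactly the vertex subsets $W$ for which there is $\mathbf{s}\in\mathcal{S}$ with $|W\cap([r_i]\times\{i\})|=s_i$ for all $i\in[d]$. It is viewed as a $d$-colored hypergraph with the coloring giving every vertex of $[r_i]\times\{i\}$ the color $i$. For a non-empty finite family $\mathcal{R}\subseteq\mathbb{Z}_{\ge0}^d$, $K^{\mathcal{S}}_{\mathcal{R}}:=\{K^{\mathcal{S}}_{\mathbf{r}}\mid\mathbf{r}\in\mathcal{R}\}$. A $d$-colored hypergraph is a pair $(G,c)$ with $G$ a hypergraph and $c:V(G)\to[d]$ an arbitrary map. A colored copy of $(H,t)$ in $(G,c)$ is a subhypergraph $\widetilde H\subseteq G$ ($V(\widetilde H)\subseteq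 V(G)$, $E(\widetilde H)\subseteq E(G)$) with coloring $c|_{V(\widetilde H)}$ such that there is a bijection $f:V(\widetilde H)\to V(H)$ with $S\in E(\widetilde H)\iff f(S)\in E(H)$ for all $S\subseteq V(\widetilde H)$ and $c(v)=t(f(v))$ for all $v\in V(\widetilde H)$. Given a $d$-colored hypergraph $(G,c)$ and a non-empty family $\mathcal{H}$ of $d$-colored hypergraphs, a spanning subhypergraph $F$ of $G$ ($V(F)=V(G)$, $E(F)\subseteq E(G)$, with the same coloring $c$) is weakly $\mathcal{H}$-saturated in $(G,c)$ if there is an ordering $e_1,\dots,e_k$ of the edges in $E(G)\setminus E(F)$ such that each $e_i$ belongs to a colored copy of some $(H,t)\in\mathcal{H}$ in $(F\cup\{e_1,\dots,e_i\},c)$. The colored weak saturation number $\mathrm{c\text{-}wsat}((G,c),\mathcal{H})$ is the minimum number of edges of such an $F$. *)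

(* Defs.v *)
From HB Require Import structures.
From mathcomp Require Import all_boot all_order all_algebra.
From mathcomp Require Import finmap boolp.

Set Implicit Arguments.
Unset Strict Implicit.
Unset Printing Implicit Defensive.

Import GRing.Theory.

Notation vec d := {ffun 'I_d -> nat}.

(* Colors and coordinates are indexed by 'I_d = {0, ..., d-1} in place of [d]. *)
Record chypergraph (d : nat) := CHypergraph {
  vert : finType;
  edges : {set {set vert}};
  color : vert -> 'I_d
}.

(* The part [r_i] x {i} is the fiber of [tag] over i. *)
Definition Kvert (d : nat) (r : vec d) : finType := {i : 'I_d & 'I_(r i)}.

Definition Kedges (d : nat) (S : {fset vec d}) (r : vec d) :
    {set {set Kvert r}} :=
  [set W : {set Kvert r} |
    [exists s : S, forall i : 'I_d,
      #|[set x in W | tag x == i]| == fsval s i]].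

Definition Khyp (d : nat) (S : {fset vec d}) (r : vec d) : chypergraph d :=
  CHypergraph (Kedges S r) (fun x : Kvert r => tag x).

Definition Kfamily (d : nat) (S R : {fset vec d}) : chypergraph d -> Prop :=
  fun H => exists2 r, r \in R & H = Khyp S r.

Definition spanning (d : nat) (G : chypergraph d) (F : {set {set vert G}}) :
    chypergraph d :=
  CHypergraph F (@color d G).

(* (W, E) are the vertex and edge sets of a colored copy of H in G.  The       *)
(* bijection is defined on the subtype W only, since H may have no vertices;   *)
(* the subsets of W are the images under [val] of the sets of that subtype.    *)
Definition colored_copy (d : nat) (G H : chypergraph d)
    (W : {set vert G}) (E : {set {set vert G}}) : Prop :=
  [/\ E \subset edges G,
      forall e, e \in E -> e \subset W &
      exists f : {x : vert G | x \in W} -> vert H,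
        [/\ bijective f,
            forall A : {set {x : vert G | x \in W}},
              (val @: A \in E) <-> (f @: A \in edges H) &
            forall x, color (val x) = color (f x)]].

Definition in_colored_copy (d : nat) (G : chypergraph d)
    (HH : chypergraph d -> Prop) (e : {set vert G}) : Prop :=
  exists (H : chypergraph d) (W : {set vert G}) (E : {set {set vert G}}),
    [/\ HH H, colored_copy H W E & e \in E].

Definition weakly_saturated (d : nat) (G : chypergraph d)
    (HH : chypergraph d -> Prop) (F : {set {set vert G}}) : Prop :=
  F \subset edges G /\
  exists es : seq {set vert G},
    [/\ uniq es,
        es =i edges G :\: F &
        forall i, i < size es ->
          @in_colored_copy d (spanning (F :|: [set e in take i.+1 es])) HH
            (nth set0 es i)].

(* The minimum is over a non-empty set of F, as it contains [edges G].         *)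
Definition cwsat (d : nat) (G : chypergraph d) (HH : chypergraph d -> Prop) :
    nat :=
  #|[arg min_(F < edges G | `[< weakly_saturated HH F >]) #|F|]|.

Lemma weakly_saturated_edges (d : nat) (G : chypergraph d)
    (HH : chypergraph d -> Prop) : weakly_saturated HH (edges G).
Proof.
split=> //; exists [::]; split=> // e.
by rewrite finset.setDv finset.in_set0.
Qed.

Lemma cwsat_attained (d : nat) (G : chypergraph d)
    (HH : chypergraph d -> Prop) :
  exists2 F : {set {set vert G}}, weakly_saturated HH F & #|F| = cwsat G HH.
Proof.
rewrite /cwsat; case: arg_minnP; first exact/asboolP/weakly_saturated_edges.
by move=> F /asboolP HF _; exists F.
Qed.

Lemma cwsat_le (d : nat) (G : chypergraph d) (HH : chypergraph d -> Prop)
    (F : {set {set vert G}}) : weakly_saturated HH F -> cwsat G HH <= #|F|.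
Proof.
move=> HF; rewrite /cwsat; case: arg_minnP => [|F' _ minF'].
  exact/asboolP/weakly_saturated_edges.
exact/minF'/asboolP.
Qed.

Local Open Scope fset_scope.

Definition box (d : nat) (s : vec d) : {fset vec d} :=
  [fset m in [seq ([ffun i => nat_of_ord (f i)] : vec d)
               | f : {dffun forall i : 'I_d, 'I_(s i).+1}]].

Definition downset (d : nat) (S : {fset vec d}) : {fset vec d} :=
  \bigcup_(s <- S) box s.

Lemma in_box (d : nat) (s m : vec d) :
  reflect (forall i, m i <= s i) (m \in box s).
Proof.
rewrite /box in_fset_ /=; apply: (iffP codomP) => [[f ->] i | le_ms].
  by rewrite ffunE -ltnS ltn_ord.
exists (finfun (fun i => Ordinal (le_ms i : m i < (s i).+1))).
by apply/ffunP => i; rewrite !ffunE.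
Qed.

Lemma in_downset (d : nat) (S : {fset vec d}) (m : vec d) :
  m \in downset S <-> exists2 s, s \in S & forall i, m i <= s i.
Proof.
split=> [/bigfcupP[s /andP[sS _] /in_box le_ms] | [s sS /in_box ms]].
  by exists s.
by apply/bigfcupP; exists s; rewrite ?sS.
Qed.

Definition restr (d : nat) (R : {fset vec d}) (n : vec d) : {fset vec d} :=
  [fset r in R | [forall i, r i <= n i]].

Local Open Scope ring_scope.

(* On the index set of this sum, m_i >= 1 and max_(r in Q) r_i <= n_i, so the  *)
(* truncated subtractions of nat are exact.                                    *)
Definition q (d : nat) (n : vec d) (S R : {fset vec d}) : int :=
  \sum_(m <- downset S)
    \sum_(Q <- fpowerset (restr R n) | Q != fset0)
      (-1) ^+ #|` Q|.+1 *
      (\prod_(i < d | m i != 0)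
         'C(m i - 1 + n i - \max_(r <- Q) (r : vec d) i, m i))%N%:Z.

(* Main.v *)
(** Lower bound. Give the vertex [j] of each color the coordinate [j+1], and for a
    vertex set [A] let [g_i] be the polynomial with constant term 1 vanishing exactly
    at the vertices of color [i] outside [A]; its degree is [n_i - |A_i|].  The vector
    [y_A(W) = prod_{w in W} g_{color w}(w)], indexed by the edges [W], has support
    [{W | W \subset A}].  Expanding [y_A] in monomials of the coefficients of the
    [g_i] shows that all the vectors coming from copies of the [K_r], [r \in R(n)],
    lie in a space spanned by as many vectors as there are monomials that have
    multidegree in the down-closure of [S] and, for some [r], involve only the
    coefficients of index at most [n_i - r_i].  By inclusion-exclusion this
    number is [q].  The edges added by a saturation process, paired with the copies
    that they complete, form a triangular matrix with nonzero diagonal, so there are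
    at most [q] of them.

    Tightness.  If [S] has a maximum [s0], remove the edges of type [s0] which, for
    some [r \in R(n)], avoid the first [r_i - s0_i] vertices of every color [i], and
    restore them by increasing sum of vertices.  If [R] has a minimum [r0], take the
    sets [Y] of degree vector [m] in the down-closure of [S] whose elements of color
    [i] all come after the vertex number [r0_i - m_i + 1], pick [s \in S] above [m],
    remove for each [Y] the edge made of [Y] and of the vertices number
    [r0_i - s_i + 1, ..., r0_i - m_i], and restore these by increasing [|Y|]. *)

Require Import Defs.
From HB Require Import structures.
From mathcomp Require Import all_boot all_order all_algebra.
From mathcomp Require Import finmap boolp.
From mathcomp Require Import zify.

Set Implicit Arguments.
Unset Strict Implicit.
Unset Printing Implicit Defensive.

Import Order.TTheory GRing.Theory Num.Theory.
Local Open Scope fset_scope.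
Local Open Scope ring_scope.

(** * Counting *)

Lemma big_fpowerset (K : choiceType) (V : zmodType) (A : {fset K})
    (F : {fset K} -> V) :
  \sum_(Q <- fpowerset A) F Q = \sum_(J : {set A}) F [fset val a | a in J].
Proof.
rewrite /fpowerset big_imfset /=.
  rewrite big_enum_cond /=.
  by apply: eq_bigl => J; rewrite powersetE subsetT.
move=> X Y _ _ /fsetP eqXY; apply/setP => a.
have memE (J : {set A}) : (val a \in [fset val y | y in J]) = (a \in J).
  apply/imfsetP/idP => [[b /= bJ /val_inj->] //|aJ]; exists a => //.
by rewrite -!memE eqXY.
Qed.

Lemma card_set_sum (T : finType) (P : pred T) : (#|[set x | P x]| = \sum_x P x)%N.
Proof. by rewrite cardsE -sum1_card big_mkcond. Qed.

(** For each [x], the indicator of the union is 1 minus the product over [A] of 1 minus the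
    indicators. Expanding the product gives the alternating sum; its term for the empty set cancels
    the 1. *)
Lemma inclusion_exclusion (K : choiceType) (T : finType) (A : {fset K})
    (M : K -> {set T}) :
  #|[set x | [exists r : A, x \in M (val r)]]|%:Z =
  \sum_(Q <- fpowerset A | Q != fset0)
    (-1) ^+ #|` Q|.+1 * #|[set x | [forall r : Q, x \in M (val r)]]|%:Z.
Proof.
have cardE (P : pred T) : #|[set x | P x]|%:Z = \sum_x (P x)%:Z.
  by rewrite card_set_sum (big_morph Posz PoszD (erefl _)).
under eq_bigr => Q _ do rewrite cardE mulr_sumr.
rewrite cardE exchange_big /=; apply: eq_bigr => x _.
pose c (r : K) : int := (x \in M r)%:Z.
have prodc (Q : {fset K}) :
    [forall r : Q, x \in M (val r)]%:Z = \prod_(r <- Q) c r.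
  rewrite big_seq_fsetE /=; case: (boolP [forall r, _]) => [/forallP Mx|].
    by rewrite big1 // => r _; rewrite /c Mx.
  by rewrite negb_forall => /existsP[r /negPf Mr]; rewrite (bigD1 r) //= /c Mr mul0r.
have -> : [exists r : A, x \in M (val r)]%:Z = 1 - \prod_(r : A) (- c (val r) + 1).
  case: (boolP [exists r, _]) => [/existsP[r Mr]|/existsPn noM].
    by rewrite (bigD1 r) //= {1}/c Mr addNr mul0r subr0.
  by rewrite big1 ?subrr // => r _; rewrite /c (negPf (noM r)) oppr0 add0r.
rewrite bigA_distr.
transitivity (1 - \sum_(Q <- fpowerset A) (-1) ^+ #|` Q| * \prod_(r <- Q) c r).
  congr (1 - _); rewrite big_fpowerset; apply: eq_bigr => J _.
  rewrite big_imfset /= => [|? ? _ _]; last exact: val_inj.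
  rewrite card_imfset /=; last exact: val_inj.
 by rewrite big_enum -fintype.cardE -prodrN [RHS]big_mkcond.
rewrite (bigD1_seq fset0) /= ?fset_uniq ?fpowersetE ?fsub0set //.
rewrite expr0 mul1r big_nil opprD addrA subrr add0r -sumrN.
apply: eq_bigr => Q _.
by rewrite prodc exprS -mulrA mulN1r.
Qed.

Definition deg (d : nat) (n : vec d) (W : {set Kvert n}) : vec d :=
  [ffun i => #|[set x in W | tag x == i]|].

(** A vertex set amounts to an independent choice of its color classes, which [parts] lists; the
    class of color [i] is any [k i]-subset of [Z i]. *)
Lemma card_deg (d : nat) (n : vec d) (b : pred (Kvert n)) (k : vec d) :
  #|[set W : {set Kvert n} | (deg W == k) && [forall x in W, b x]]| =
  (\prod_(i < d) 'C(#|[set x | (tag x == i) && b x]|, k i))%N.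
Proof.
pose Z i := [set x : Kvert n | (tag x == i) && b x].
pose parts (W : {set Kvert n}) := [ffun i => [set x in W | tag x == i]].
pose D i := [set X : {set Kvert n} | (X \subset Z i) && (#|X| == k i)].
have parts_inj : injective parts.
  move=> W W' /ffunP eqW; apply/setP => x.
  by have /setP/(_ x) := eqW (tag x); rewrite !ffunE !inE eqxx !andbT.
rewrite -(card_imset _ parts_inj).
transitivity #|family (fun i => mem (D i))|.
  apply: eq_card => f; apply/imsetP/familyP => [[W]|fD].
    rewrite inE => /andP[/eqP/ffunP degW /forall_inP bW] -> i.
    rewrite !inE -degW !ffunE eqxx andbT.
    by apply/subsetP => x; rewrite !inE => /andP[xW ->]; exact: bW.
  have fE i x : x \in f i -> tag x = i /\ b x.
    move=> fx; have /[!inE]/andP[/subsetP/(_ x fx) + _] := fD i.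
    by rewrite inE => /andP[/eqP].
  have partE i : [set x in \bigcup_j f j | tag x == i] = f i.
    apply/setP => x; rewrite inE; apply/andP/idP => [[/bigcupP[j _ fx] /eqP<-]|fx].
      by rewrite (fE _ _ fx).1.
    by rewrite (fE _ _ fx).1; split=> //; apply/bigcupP; exists i.
  exists (\bigcup_i f i); last by apply/ffunP => i; rewrite ffunE partE.
  rewrite inE; apply/andP; split.
    apply/eqP/ffunP => i; rewrite ffunE partE.
    by have /[!inE]/andP[_ /eqP] := fD i.
  by apply/forall_inP => x /bigcupP[j _ /fE[]].
rewrite card_family foldrE big_map big_enum /=.
by apply: eq_bigr => i _; rewrite -cards_draws; apply: eq_card => X; rewrite !inE.
Qed.

Lemma card_fiber_sum (T : finType) (K : choiceType) (f : T -> K) (A : {fset K})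
    (P : pred T) :
  (#|[set x | (f x \in A) && P x]| =
   \sum_(m <- A) #|[set x | (f x == m) && P x]|)%N.
Proof.
under eq_bigr => m _ do rewrite card_set_sum.
rewrite card_set_sum exchange_big; apply: eq_bigr => x _ /=.
case: (boolP (f x \in A)) => fxA /=.
  rewrite (bigD1_seq (f x)) //= eqxx big1 ?addn0 // => m.
  by rewrite eq_sym => /negPf->.
by rewrite big1_seq // => m /andP[_ mA]; case: eqP => // eqm; rewrite eqm mA in fxA.
Qed.

(** The number of monomials of degree [m] in [u] variables; the case split follows the condition
    [m i != 0] in [q]. *)
Definition mchoose (u m : nat) : nat := if m == 0%N then 1%N else 'C(m - 1 + u, m).

Lemma sum_mchoose (u s : nat) : (\sum_(m < s.+1) mchoose u m = 'C(u + s, s))%N.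
Proof.
elim: s => [|s IHs]; first by rewrite big_ord1 bin0.
by rewrite big_ord_recr IHs /mchoose /= subn1 /= addnS binS addnC (addnC s).
Qed.

Lemma mchoose_sub (N r m : nat) : (m <= r)%N -> (r <= N)%N ->
  'C(N - (r.+1 - m), m) = mchoose (N - r) m.
Proof.
case: m => [|m] le_mr le_rN; first by rewrite bin0.
by congr 'C(_, _); lia.
Qed.

(** Here [k] is the exponent vector of a monomial in the first [u] of [N] variables. The bound [B]
    on the exponents excludes no monomial of degree [m], since [m <= B]. *)
Lemma card_multisets (N B u m : nat) : (u <= N)%N -> (m <= B)%N ->
  #|[set k : {ffun 'I_N -> 'I_B.+1} |
      (\sum_j k j == m)%N && [forall j, (0 < k j)%N ==> (j < u)%N]]| = mchoose u m.
Proof.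
(* The case of no variables is separate, because [card_ord_partitions] counts tuples of positive
   length. *)
case: u => [_ lemB|u ltuN lemB].
  rewrite /mchoose addn0; case: m lemB => [|m] lemB /=; last first.
    rewrite bin_small ?subn1 // eq_card0 // => k; rewrite !inE.
    apply/andP => -[/eqP sumk /forallP k0]; move: sumk; rewrite big1 // => j _.
    by have := k0 j; rewrite ltn0 implybF -leqNgt leqn0 => /eqP.
  rewrite (@eq_card1 _ [ffun=> ord0]) // => k; rewrite !inE.
  apply/andP/eqP => [[sumk _]|->].
    apply/ffunP => j; apply/val_inj; rewrite ffunE /=.
    by move: sumk; rewrite sum_nat_eq0 => /forallP/(_ j)/eqP.
  split; first by rewrite big1 // => j _; rewrite ffunE.
  by apply/forallP => j; rewrite ffunE.
have -> : mchoose u.+1 m = 'C(u + m, m).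
  by rewrite /mchoose; case: m lemB => [|m] _; rewrite ?bin0 //= subSS subn0 !addnS addnC.
rewrite -[in RHS]bin_sub ?leq_addl // addnK -card_ord_partitions.
pose w := widen_ord ltuN.
have sumw (k : {ffun 'I_N -> 'I_B.+1}) :
    (forall j : 'I_N, (u < j)%N -> k j = 0%N :> nat) ->
    (\sum_j k j = \sum_(i < u.+1) k (w i))%N.
  move=> k0; rewrite -(big_ord_narrow (F := fun j => k j : nat) ltuN) [RHS]big_mkcond /=.
  by apply: eq_bigr => j _; rewrite ltnS; case: leqP => // /k0.
(* A tuple is extended by zeros to all [N] variables; [inord] is exact because the entries are at
   most [m <= B]. *)
pose g (t : u.+1.-tuple 'I_m.+1) : {ffun 'I_N -> 'I_B.+1} :=
  [ffun j : 'I_N => inord (nth ord0 t j)].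
have gw t i : g t (w i) = tnth t i :> nat.
  rewrite ffunE (tnth_nth ord0) inordK // ltnS; apply: leq_trans lemB.
  by rewrite -ltnS ltn_ord.
have g0 t (j : 'I_N) : (u < j)%N -> g t j = 0%N :> nat.
  by move=> ltuj; rewrite ffunE nth_default ?size_tuple // inordK.
have g_inj : injective g.
  move=> t t' eqg; apply/eq_from_tnth => i; apply/val_inj.
  by rewrite /= -!gw eqg.
rewrite -(card_imset _ g_inj); apply: eq_card => k; rewrite inE.
apply/andP/imsetP => [[/eqP sumk /forallP k0]|[t]]; last first.
  rewrite inE big_tuple => sumt ->; split.
    rewrite sumw; last exact: g0.
    by under eq_bigr do rewrite gw.
  by apply/forallP => j; rewrite ltnS; case: (leqP j u) => [|/g0->]; rewrite ?implybT.
have {}k0 (j : 'I_N) : (u < j)%N -> k j = 0%N :> nat.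
  by move=> ltuj; have := k0 j; rewrite ltnS (leqNgt j) ltuj implybF -leqNgt leqn0 => /eqP.
have kE i : @inord m (k (w i)) = k (w i) :> nat.
  by rewrite inordK // ltnS -sumk (bigD1 (w i)) //= leq_addr.
exists [tuple inord (k (w i)) | i < u.+1].
  by rewrite inE big_tuple; under eq_bigr do rewrite tnth_mktuple kE; rewrite -sumw ?sumk.
apply/ffunP => j; apply/val_inj; case: (ltnP u j) => [ltuj|leju].
  by rewrite /= k0 ?g0.
have -> : j = w (Ordinal (leju : j < u.+1)%N) by apply/val_inj.
by rewrite /= gw tnth_mktuple kE.
Qed.

(** * Copies and saturation *)

Lemma card_color_range (d : nat) (n : vec d) (i : 'I_d) (a b : nat) :
  (b <= n i)%N ->
  #|[set x : Kvert n | (tag x == i) && (a <= tagged x < b)%N]| = (b - a)%N.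
Proof.
move=> le_bn; pose g (j : 'I_(n i)) : Kvert n := Tagged (fun i => 'I_(n i)) j.
have g_inj : injective g by move=> j j' /eqP; rewrite eq_Tagged /= => /eqP.
transitivity #|g @: [set j : 'I_(n i) | (a <= j < b)%N]|.
  apply: eq_card => x; rewrite inE; apply/andP/imsetP => [[]|[j + ->]].
    case: x => i' j /= /eqP eqi; rewrite -{}eqi in g {g_inj le_bn} * => Hj.
    by exists j; rewrite ?inE.
  by rewrite inE eqxx.
rewrite card_imset // -sum1dep_card.
rewrite -(big_ord_widen_cond _ (fun j => a <= j)%N (fun=> 1%N) le_bn).
by rewrite -(big_geq_mkord _ _ predT (fun=> 1%N)) sum_nat_const_nat muln1.
Qed.

Lemma deg_setT (d : nat) (r : vec d) : deg [set: Kvert r] = r.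
Proof.
apply/ffunP => i; rewrite ffunE -[RHS]subn0 -(card_color_range 0 (leqnn (r i))).
by apply: eq_card => x; rewrite !inE; case: eqP => // <-; rewrite ltn_ord.
Qed.

Lemma deg_le (d : nat) (n : vec d) (i : 'I_d) (A B : {set Kvert n}) :
  A \subset B -> (deg A i <= deg B i)%N.
Proof.
move=> /subsetP subAB; rewrite !ffunE; apply/subset_leq_card/subsetP => x.
by rewrite !inE => /andP[/subAB-> ->].
Qed.

Lemma deg_le_n (d : nat) (n : vec d) (A : {set Kvert n}) (i : 'I_d) :
  (deg A i <= n i)%N.
Proof. by rewrite -[X in (_ <= X)%N](congr1 (fun f : vec d => f i) (deg_setT n)) deg_le ?subsetT. Qed.

Lemma sum_deg (d : nat) (n : vec d) (A : {set Kvert n}) :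
  (\sum_i deg A i = #|A|)%N.
Proof.
rewrite -sum1_card (partition_big (fun x => tag x) predT) //=.
by apply: eq_bigr => i _; rewrite ffunE -sum1dep_card.
Qed.

Lemma deg_imset (d : nat) (n : vec d) (T : finType) (g : T -> Kvert n)
    (c : T -> 'I_d) (B : {set T}) : injective g -> (forall x, tag (g x) = c x) ->
  deg (g @: B) = [ffun i => #|[set x in B | c x == i]|].
Proof.
move=> g_inj tag_g; apply/ffunP => i; rewrite !ffunE -(card_imset _ g_inj).
apply: eq_card => y; rewrite inE; apply/andP/imsetP => [[/imsetP[x Bx ->]]|[x]].
  by rewrite tag_g => cx; exists x; rewrite // inE Bx.
by rewrite inE -tag_g => /andP[Bx tagx] ->; rewrite imset_f.
Qed.

Lemma mem_Kedges (d : nat) (S : {fset vec d}) (n : vec d) (W : {set Kvert n}) :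
  (W \in Kedges S n) = (deg W \in S).
Proof.
rewrite inE; apply/existsP/idP => [[s /forallP degW]|degW].
  suff -> : deg W = val s by exact: valP.
  by apply/ffunP => i; rewrite ffunE; apply/eqP/degW.
by exists [` degW]; apply/forallP => i; rewrite ffunE.
Qed.

(** By [colored_copyE], the only possible edge set of a colored copy on the vertex set [A]. *)
Definition copy_edges (d : nat) (S : {fset vec d}) (n : vec d)
  (A : {set Kvert n}) : {set {set Kvert n}} :=
  [set W in Kedges S n | W \subset A].

(** Each vertex of [A] is sent to its position in an enumeration of its color class in [A]. *)
Lemma color_bijection (d : nat) (n : vec d) (A : {set Kvert n}) :
  exists f : {x : Kvert n | x \in A} -> Kvert (deg A),
    bijective f /\ forall x, tag (val x) = tag (f x).
Proof.
pose color_class i := enum [set y in A | tag y == i].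
have in_class (x : {x : Kvert n | x \in A}) : val x \in color_class (tag (val x)).
  by rewrite mem_enum inE eqxx (valP x).
have lt_index (x : {x : Kvert n | x \in A}) :
    (index (val x) (color_class (tag (val x))) < deg A (tag (val x)))%N.
  by rewrite ffunE [ltnRHS]cardE index_mem.
pose f (x : {x : Kvert n | x \in A}) : Kvert (deg A) :=
  Tagged (fun i => 'I_(deg A i)) (Ordinal (lt_index x)).
exists f; split=> //; apply: inj_card_bij => [x y eqf|].
  have eqt : tag (val x) = tag (val y) := congr1 tag eqf.
  have /= := congr1 (fun u : Kvert (deg A) => val (tagged u)) eqf.
  rewrite -eqt => /(congr1 (nth (val x) (color_class (tag (val x))))).
  rewrite !nth_index ?in_class // => [/val_inj //|].
  by rewrite {1}eqt in_class.
rewrite card_sig -[leqRHS]sum_deg -[in leqLHS]cardsT -sum_deg.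
by rewrite deg_setT.
Qed.

Lemma colored_copy_edges (d : nat) (S : {fset vec d}) (n : vec d)
    (F : {set {set Kvert n}}) (A : {set Kvert n}) :
  copy_edges S A \subset F ->
  @colored_copy d (@spanning d (Khyp S n) F) (Khyp S (deg A)) A (copy_edges S A).
Proof.
move=> subF; split=> //= [e|]; first by rewrite inE => /andP[].
have [f [f_bij tag_f]] := color_bijection A; exists f; split=> // B.
rewrite inE !mem_Kedges (deg_imset _ (@val_inj _ _ _) tag_f).
rewrite (deg_imset _ (bij_inj f_bij) (fun x => erefl)).
split=> [/andP[]//|->]; apply/subsetP => _ /imsetP[x _ ->]; exact: valP.
Qed.

(** A color-preserving bijection preserves degree vectors, and these decide which sets are edges. A
    copy is therefore induced, and its vertex set determines it. *)
Lemma colored_copyE (d : nat) (S : {fset vec d}) (n r : vec d)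
    (F : {set {set Kvert n}}) (A : {set Kvert n}) (E : {set {set Kvert n}}) :
  @colored_copy d (@spanning d (Khyp S n) F) (Khyp S r) A E ->
  [/\ deg A = r, E = copy_edges S A & E \subset F].
Proof.
case=> /= EF subA [f [f_bij f_edges tag_f]].
have degf (B : {set {x : Kvert n | x \in A}}) : deg (val @: B) = deg (f @: B).
  rewrite (deg_imset _ (@val_inj _ _ _) tag_f).
  by rewrite (deg_imset _ (bij_inj f_bij) (fun x => erefl)).
have liftA (W : {set Kvert n}) : W \subset A ->
    exists B : {set {x : Kvert n | x \in A}}, W = val @: B.
  move=> /subsetP WA; exists [set x | val x \in W]; apply/setP => x.
  apply/idP/imsetP => [Wx|[y + ->]]; last by rewrite inE.
  by exists (exist _ x (WA x Wx)); rewrite ?inE.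
split=> //.
  have [B defA] := liftA _ (subxx A).
  have BT : B = setT.
    apply/setP => x; rewrite inE -(mem_imset _ _ (@val_inj _ _ _)) -defA.
    exact: valP.
  rewrite defA degf BT -[RHS]deg_setT; congr deg; apply/setP => y; rewrite inE.
  by have [g _ fK] := f_bij; rewrite -[y]fK imset_f.
apply/setP => W; rewrite inE mem_Kedges; apply/idP/andP => [EW|[degW WA]].
  have WA := subA _ EW; split=> //; have [B defW] := liftA _ WA.
  by rewrite defW degf -mem_Kedges; apply/f_edges; rewrite -defW.
by have [B defW] := liftA _ WA; rewrite defW; apply/f_edges; rewrite mem_Kedges -degf -defW.
Qed.

(** The edges of [D] are restored by increasing [p]: any other edge of [D] inside the copy on [A]
    has strictly smaller rank, hence comes before [e] however ties are broken. *)
Lemma weakly_saturated_setD (d : nat) (S R : {fset vec d}) (n : vec d)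
    (D : {set {set Kvert n}}) (p : {set Kvert n} -> nat) :
  D \subset Kedges S n ->
  (forall e, e \in D -> exists A : {set Kvert n}, [/\ deg A \in R, e \subset A &
    forall e', e' \in D -> e' \subset A -> e' != e -> (p e' < p e)%N]) ->
  @weakly_saturated d (Khyp S n) (Kfamily S R) (Kedges S n :\: D).
Proof.
move=> subD copyD; split; first exact: subsetDl.
pose le e e' := (p e <= p e')%N.
have le_trans : transitive le by move=> e1 e2 e3; exact: leq_trans.
have le_total : total le by move=> e1 e2; exact: leq_total.
pose es := sort le (enum D); have es_uniq : uniq es by rewrite sort_uniq enum_uniq.
have mem_es e : (e \in es) = (e \in D) by rewrite mem_sort mem_enum.
exists es; split=> // [e|i lti].
  rewrite mem_es !finset.in_setD /=.
  by case: (boolP (e \in D)) => [/(subsetP subD)->|_] //; rewrite andNb.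
set e := nth set0 es i; have De : e \in D by rewrite -mem_es mem_nth.
have [A [degA eA smallA]] := copyD e De.
exists (Khyp S (deg A)), A, (copy_edges S A); split; first by exists (deg A).
  apply: colored_copy_edges; apply/subsetP => e'; rewrite inE => /andP[Ke' e'A].
  rewrite finset.in_setU finset.in_setD Ke' andbT.
  case: (boolP (e' \in D)) => //= De'; rewrite inE; have [->|ne'] := eqVneq e' e.
    by rewrite (take_nth set0) // mem_rcons inE eqxx.
  have e'es : e' \in es by rewrite mem_es.
  rewrite in_take_leq // ltnS ltnW // ltnNge; apply/negP => le_i.
  have := smallA e' De' e'A ne'; rewrite ltnNge => /negP; apply.
  rewrite -[e'](nth_index set0 e'es).
  by apply: (sorted_leq_nth le_trans (fun e => leqnn _)); rewrite ?inE ?index_mem ?sort_sorted.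
by rewrite inE (subsetP subD).
Qed.

(** Copies are induced, so all edges inside [A i] are present after step [i]; an edge added later
    cannot be among them. *)
Lemma weakly_saturated_triangular (d : nat) (S R : {fset vec d}) (n : vec d)
    (F : {set {set Kvert n}}) :
  @weakly_saturated d (Khyp S n) (Kfamily S R) F ->
  exists (e A : 'I_#|Kedges S n :\: F| -> {set Kvert n}), forall i,
    [/\ e i \in Kedges S n, deg (A i) \in R, e i \subset A i &
      forall j : 'I_#|Kedges S n :\: F|, (i < j)%N -> ~~ (e j \subset A i)].
Proof.
case=> subF [es [es_uniq mem_es copy_es]].
have size_es : size es = #|Kedges S n :\: F|.
  by rewrite -(card_uniqP es_uniq); apply: eq_card => e; rewrite mem_es.
rewrite -size_es.
have es_copy (i : 'I_(size es)) : exists A : {set Kvert n}, [/\ deg A \in R,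
    nth set0 es i \subset A & copy_edges S A \subset F :|: [set e in take i.+1 es]].
  have [H [A [E [[r rR ->] copyA Ei]]]] := copy_es i (ltn_ord i).
  have [degA defE subE] := colored_copyE copyA; exists A; split.
  - by rewrite degA.
  - by move: Ei; rewrite defE inE => /andP[].
  - by rewrite -defE.
have /fin_all_exists[A HA] := es_copy.
have Kes i : (i < size es)%N -> (nth set0 es i \in Kedges S n) && (nth set0 es i \notin F).
  by move=> lti; have := mem_nth set0 lti; rewrite mem_es !inE andbC.
exists (fun i => nth set0 es i), A => i; have [degA eA copyA] := HA i.
split=> // [|j ltij]; first by have /andP[] := Kes i (ltn_ord i).
have /andP[Kj /negPf notFj] := Kes j (ltn_ord j).
apply/negP => ejA; have : nth set0 es j \in F :|: [set e in take i.+1 es].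
  by apply: (subsetP copyA); rewrite inE Kj.
rewrite !inE notFj /= in_take_leq // index_uniq //.
by rewrite ltnS leqNgt ltij.
Qed.

(** * The monomials counted by [q] *)

Definition vmax (d : nat) (Q : {fset vec d}) : vec d :=
  [ffun i => \max_(r <- Q) (r : vec d) i].

Lemma vmax_leP (d : nat) (Q : {fset vec d}) (i : 'I_d) (b : nat) :
  reflect (forall r : vec d, r \in Q -> r i <= b)%N (vmax Q i <= b)%N.
Proof.
rewrite ffunE; apply: (iffP idP) => [le_b r rQ|le_b].
  by apply: leq_trans le_b; rewrite (bigD1_seq r) ?fset_uniq //= leq_maxl.
by rewrite big_seq; elim/big_ind: _ => // a c; rewrite geq_max => -> ->.
Qed.

Lemma vmax_restr (d : nat) (R Q : {fset vec d}) (n : vec d) (i : 'I_d) :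
  Q \in fpowerset (restr R n) -> (vmax Q i <= n i)%N.
Proof.
rewrite fpowersetE => /fsubsetP subQ; apply/vmax_leP => r /subQ.
by rewrite !inE /= => /andP[_ /forallP].
Qed.

(* The number of monomials of multidegree in [downset S], in [n i - t i] variables *)
(* of each color i.                                                               *)
Definition nmon (d : nat) (n : vec d) (S : {fset vec d}) (t : vec d) : nat :=
  (\sum_(m <- downset S) \prod_(i < d) mchoose (n i - t i) (m i))%N.

Lemma q_mchoose (d : nat) (n : vec d) (S R : {fset vec d}) :
  q n S R = \sum_(Q <- fpowerset (restr R n) | Q != fset0)
    (-1) ^+ #|` Q|.+1 * (nmon n S (vmax Q))%:Z.
Proof.
rewrite /q exchange_big [LHS]big_seq_cond [RHS]big_seq_cond /=.
apply: eq_bigr => Q /andP[QR _]; rewrite -mulr_sumr; congr (_ * _).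
rewrite (big_morph Posz PoszD (erefl _)); apply: eq_bigr => m _; congr Posz.
rewrite big_mkcond; apply: eq_bigr => i _; rewrite /mchoose.
have := vmax_restr i QR; rewrite ffunE => le_n.
by case: (m i == 0%N) => //=; rewrite addnBA.
Qed.

(** The entry [k i j] is the exponent of the coefficient of index [j.+1] of the polynomial of color
    [i]. The uniform bounds make the type finite and leave room for every monomial in the expansion
    of [copy_vector]. *)
Definition exponent (d : nat) (n : vec d) : finType :=
  {ffun 'I_d -> {ffun 'I_(\max_i n i) -> 'I_#|Kvert n|.+1}}.

Definition edeg (d : nat) (n : vec d) (k : exponent n) : vec d :=
  [ffun i => \sum_j k i j]%N.

(** When [deg A = r], the polynomial [vanishing A i] has degree at most [n i - r i], so only the
    coefficients with [j < n i - r i] can be nonzero. *)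
Definition exponents (d : nat) (n : vec d) (S : {fset vec d}) (r : vec d) :
    {set exponent n} :=
  [set k | (edeg k \in downset S) &&
    [forall i, forall j, (0 < k i j)%N ==> (j < n i - r i)%N]].

Definition exponents_union (d : nat) (n : vec d) (S R : {fset vec d}) :
    {set exponent n} :=
  [set k | [exists r : restr R n, k \in exponents n S (val r)]].

Lemma n_le_card (d : nat) (n : vec d) (i : 'I_d) : (n i <= #|Kvert n|)%N.
Proof.
by rewrite -[in leqLHS](deg_setT n) -[leqRHS]cardsT -sum_deg (bigD1 i) //= leq_addr.
Qed.

(** The colors are independent. The hypothesis keeps each degree [m i] below the bound [#|Kvert n|]
    on exponents, as [card_multisets] requires. *)
Lemma card_exponents (d : nat) (n : vec d) (S : {fset vec d}) (t : vec d) :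
  (forall (s : vec d) i, s \in S -> s i <= n i)%N -> #|exponents n S t| = nmon n S t.
Proof.
move=> le_sn; rewrite card_fiber_sum; apply: eq_big_seq => m mS.
pose D i := [set k : {ffun 'I_(\max_i n i) -> 'I_#|Kvert n|.+1} |
  (\sum_j k j == m i)%N && [forall j, (0 < k j)%N ==> (j < n i - t i)%N]].
transitivity #|family (fun i => mem (D i))|.
  apply: eq_card => k; rewrite inE; apply/andP/familyP => [[/eqP/ffunP degk supp] i|kD].
    by rewrite inE -degk ffunE eqxx /=; have /forallP/(_ i) := supp.
  split; last by apply/forallP => i; have := kD i; rewrite inE => /andP[].
  by apply/eqP/ffunP => i; rewrite ffunE; have := kD i; rewrite inE => /andP[/eqP].
rewrite card_family foldrE big_map big_enum; apply: eq_bigr => i _.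
rewrite -(card_multisets (N := \max_i n i) (B := #|Kvert n|)) //.
  by rewrite (leq_trans (leq_subr _ _)) // leq_bigmax.
have /in_downset[s /le_sn le_s le_m] := mS.
exact: leq_trans (le_m i) (leq_trans (le_s i) (n_le_card n i)).
Qed.

(** This is inclusion-exclusion: the monomials allowed for every [r] in a non-empty [Q] are those
    allowed for the coordinatewise maximum [vmax Q]. *)
Lemma q_card (d : nat) (n : vec d) (S R : {fset vec d}) :
  (forall (s : vec d) i, s \in S -> s i <= n i)%N ->
  q n S R = #|exponents_union n S R|%:Z.
Proof.
move=> le_sn; rewrite q_mchoose inclusion_exclusion big_seq_cond [RHS]big_seq_cond.
apply: eq_bigr => Q /andP[_ Q0]; congr (_ * _%:Z).
rewrite -card_exponents //; apply: eq_card => k; rewrite !inE.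
have lt_vmax i (j : nat) :
    reflect (forall r : vec d, r \in Q -> j < n i - r i)%N (j < n i - vmax Q i)%N.
  apply: (iffP idP) => [ltj r rQ|ltj].
    by have /vmax_leP/(_ r rQ) := leqnn (vmax Q i); lia.
  have [r0 /ltj ltj0] := fset0Pn _ Q0.
  suff : (vmax Q i <= n i - j - 1)%N by lia.
  by apply/vmax_leP => r /ltj; lia.
apply/andP/forallP => [[degk /forallP supp] r|kQ].
  rewrite inE degk; apply/forallP => i; apply/forallP => j.
  have /forallP/(_ j)/implyP suppj := supp i; apply/implyP => /suppj/lt_vmax; apply.
  exact: valP.
have [r0 r0Q] := fset0Pn _ Q0; have := kQ [` r0Q]; rewrite inE => /andP[degk _].
split=> //; apply/forallP => i; apply/forallP => j; apply/implyP => kij.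
apply/lt_vmax => r rQ; have := kQ [` rQ]; rewrite inE => /andP[_ /forallP/(_ i)].
by move=> /forallP/(_ j)/implyP/(_ kij).
Qed.

(** * Lower bound *)

(** The shift keeps coordinates nonzero, so that [vanishing] can divide by them. *)
Definition coord (d : nat) (n : vec d) (v : Kvert n) : rat := (tagged v).+1%:R.

(* Normalizing the constant coefficient, rather than the leading one, makes the *)
(* sets of nonzero coefficients nested when [deg A i] varies.                    *)
Definition vanishing (d : nat) (n : vec d) (A : {set Kvert n}) (i : 'I_d) :
    {poly rat} :=
  \prod_(v | (v \notin A) && (tag v == i)) (1 - (coord v)^-1 *: 'X).

Definition copy_vector (d : nat) (n : vec d) (A W : {set Kvert n}) : rat :=
  \prod_(w in W) (vanishing A (tag w)).[coord w].

Lemma coord_neq0 (d : nat) (n : vec d) (v : Kvert n) : coord v != 0.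
Proof. by rewrite pnatr_eq0. Qed.

Lemma vanishing_coef0 (d : nat) (n : vec d) (A : {set Kvert n}) (i : 'I_d) :
  (vanishing A i)`_0 = 1.
Proof.
rewrite -horner_coef0 horner_prod big1 // => v _.
by rewrite !hornerE ?mulr0 ?subr0.
Qed.

Lemma size_vanishing (d : nat) (n : vec d) (A : {set Kvert n}) (i : 'I_d) :
  (size (vanishing A i) <= (n i - deg A i).+1)%N.
Proof.
pose C := [set v : Kvert n | (v \notin A) && (tag v == i)].
have cardC : #|C| = (n i - deg A i)%N.
  rewrite -(congr1 (fun r : vec d => r i) (deg_setT n)) !ffunE.
  rewrite -(cardsID A [set v in [set: Kvert n] | tag v == i]).
  have -> : [set v in [set: Kvert n] | tag v == i] :&: A = [set v in A | tag v == i].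
    by apply/setP => v; rewrite !inE andbC.
  by rewrite addnC addnK; apply: eq_card => v; rewrite !inE andbC.
have -> : vanishing A i = \prod_(v in C) (1 - (coord v)^-1 *: 'X).
  by apply: eq_bigl => v; rewrite inE.
apply: leq_trans (size_poly_prod_leq _ _) _.
rewrite leq_subLR -cardC addnS ltnS addnn -mul2n.
apply: (leq_trans (n := \sum_(v in C) 2)%N); last by rewrite sum_nat_const mulnC.
apply: leq_sum => v _; rewrite (leq_trans (size_polyD _ _)) // geq_max size_poly1.
by rewrite size_polyN (leq_trans (size_scale_leq _ _)) ?size_polyX.
Qed.

(** Coordinates separate the vertices of one color, so only the factor of [w] itself can vanish at
    [coord w]. *)
Lemma vanishing_neq0 (d : nat) (n : vec d) (A : {set Kvert n}) (w : Kvert n) :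
  ((vanishing A (tag w)).[coord w] != 0) = (w \in A).
Proof.
rewrite horner_prod; apply/idP/idP => [/prodf_neq0 nz|wA].
  case: (boolP (w \in A)) => // wA; have := nz w; rewrite wA eqxx => /(_ isT).
  by rewrite !hornerE mulVf ?subrr ?eqxx // coord_neq0.
apply/prodf_neq0 => v /andP[vA /eqP tagv]; rewrite !hornerE subr_eq0 eq_sym.
apply: contraNneq vA => eq1.
have eqc : coord w = coord v by rewrite -[RHS]mulr1 -eq1 mulVKf ?coord_neq0.
suff -> : v = w by [].
move: eqc => /eqP; rewrite eqr_nat eqSS; case: v w tagv {eq1 wA} => [i j] [i' j'] /= eqi.
by move: j'; rewrite -eqi => j' /eqP/val_inj->.
Qed.

Lemma copy_vector_neq0 (d : nat) (n : vec d) (A W : {set Kvert n}) :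
  (copy_vector A W != 0) = (W \subset A).
Proof.
by apply/prodf_neq0/subsetP => H w /H; rewrite vanishing_neq0.
Qed.

(* A function [f] picking a term of degree [f w] in each factor of [copy_vector]  *)
(* contributes this exponent; [j] stands for the coefficient of index [j.+1].    *)
Definition fiber_exponent (d : nat) (n : vec d) (W : {set Kvert n})
    (f : {ffun Kvert n -> 'I_(\max_i n i).+1}) : exponent n :=
  [ffun i => [ffun j =>
    inord #|[set w in W | (tag w == i) && (f w == lift ord0 j)]|]].

Definition coef_monomial (d : nat) (n : vec d) (A : {set Kvert n})
    (k : exponent n) : rat :=
  \prod_i \prod_(j < \max_i n i) (vanishing A i)`_j.+1 ^+ k i j.

(** The coefficient of the monomial [k] in the expansion of [copy_vector A W]. It does not involve
    [A], whence the matrix factorization in [weakly_saturated_card]. The functions [f] equal [ord0]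
    outside [W], so that each choice of terms is counted once. *)
Definition dual_vector (d : nat) (n : vec d) (W : {set Kvert n})
    (k : exponent n) : rat :=
  \sum_(f in pffun_on ord0 (mem W) predT | fiber_exponent W f == k)
    \prod_(w in W) coord w ^+ f w.

Lemma fiber_exponentE (d : nat) (n : vec d) (W : {set Kvert n})
    (f : {ffun Kvert n -> 'I_(\max_i n i).+1}) (i : 'I_d) (j : 'I_(\max_i n i)) :
  fiber_exponent W f i j =
  #|[set w in W | (tag w == i) && (f w == lift ord0 j)]| :> nat.
Proof. by rewrite !ffunE inordK // ltnS max_card. Qed.

(** The factors are grouped by color, then by index. Those of index 0 equal 1, which is why
    exponents record only the indices [j.+1]. *)
Lemma prod_vanishing_coef (d : nat) (n : vec d) (A W : {set Kvert n})
    (f : {ffun Kvert n -> 'I_(\max_i n i).+1}) :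
  \prod_(w in W) (vanishing A (tag w))`_(f w) =
  coef_monomial A (fiber_exponent W f).
Proof.
rewrite (partition_big (fun w => tag w) predT) //=; apply: eq_bigr => i _.
rewrite (partition_big f predT) //= big_ord_recl /=.
rewrite big1 ?mul1r => [|w /andP[_ /eqP->]]; last by rewrite vanishing_coef0.
apply: eq_bigr => j _.
rewrite (eq_bigr (fun=> (vanishing A i)`_j.+1)); last first.
  by move=> w /andP[/andP[_ /eqP->] /eqP->].
rewrite prodr_const fiber_exponentE; congr (_ ^+ _).
by apply: eq_card => w; rewrite inE unfold_in /= andbA.
Qed.

(** Constant terms do not count toward the exponent, so its degree may drop below [deg W]: hence the
    down-closure of [S]. *)
Lemma edeg_fiber_exponent (d : nat) (n : vec d) (W : {set Kvert n})
    (f : {ffun Kvert n -> 'I_(\max_i n i).+1}) (i : 'I_d) :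
  (edeg (fiber_exponent W f) i <= deg W i)%N.
Proof.
rewrite [edeg _ _]ffunE [deg _ _]ffunE; under eq_bigr do rewrite fiber_exponentE -sum1dep_card.
rewrite -sum1dep_card (partition_big f predT) //= big_ord_recl.
rewrite -[leqLHS]add0n leq_add //; apply: leq_sum => j _.
by apply/eq_leq/eq_bigl => w; rewrite andbA.
Qed.

Lemma copy_vector_expand (d : nat) (n : vec d) (S R : {fset vec d})
    (A W : {set Kvert n}) : deg A \in R -> deg W \in S ->
  copy_vector A W =
  \sum_(k in exponents_union n S R) coef_monomial A k * dual_vector W k.
Proof.
move=> degA degW; transitivity (\sum_(f in pffun_on ord0 (mem W) predT)
    coef_monomial A (fiber_exponent W f) * \prod_(w in W) coord w ^+ f w).
  rewrite /copy_vector.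
  under eq_bigr => w _.
    rewrite (@horner_coef_wide _ (\max_i n i).+1); last first.
      rewrite (leq_trans (size_vanishing _ _)) // ltnS (leq_trans (leq_subr _ _)) //.
      exact: leq_bigmax.
    over.
  rewrite (big_distr_big ord0); apply: eq_bigr => f _.
  by rewrite big_split prod_vanishing_coef.
rewrite (partition_big (fiber_exponent W) predT) //=.
rewrite (bigID (mem (exponents_union n S R))) /= [X in _ + X]big1 ?addr0.
  apply: eq_bigr => k _; rewrite mulr_sumr.
  by apply: eq_bigr => f /andP[_ /eqP<-].
move=> k kM; rewrite big1 // => f /andP[_ /eqP defk]; rewrite defk.
suff -> : coef_monomial A k = 0 by rewrite mul0r.
have degk : edeg k \in downset S.
  by apply/in_downset; exists (deg W) => // i; rewrite -defk edeg_fiber_exponent.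
have rR : deg A \in restr R n.
  by rewrite !inE degA; apply/forallP => i; apply: deg_le_n.
(* Failing the condition for [r = deg A], the monomial [k] involves a coefficient of index above
   [n i - deg A i], which is zero. *)
move: kM; rewrite inE negb_exists => /forallP/(_ [` rR]).
rewrite inE degk negb_forall => /existsP[i]; rewrite negb_forall => /existsP[j].
rewrite negb_imply => /andP[kij ltj]; rewrite /coef_monomial.
rewrite (bigD1 i) // (bigD1 j) //= nth_default ?expr0n ?eqn0Ngt ?kij ?mul0r //.
by rewrite (leq_trans (size_vanishing _ _)) // ltnS leqNgt.
Qed.

Lemma weakly_saturated_card (d : nat) (S R : {fset vec d}) (n : vec d)
    (F : {set {set Kvert n}}) :
  @weakly_saturated d (Khyp S n) (Kfamily S R) F ->
  (#|Kedges S n| <= #|F| + #|exponents_union n S R|)%N.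
Proof.
move=> satF; have [e [A copyA]] := weakly_saturated_triangular satF.
set k := #|_| in e A copyA; set M := exponents_union n S R.
suff le_k : (k <= #|M|)%N.
  have [subF _] := satF; move: le_k; rewrite /k cardsD.
  by rewrite (setIidPr subF); have := subset_leq_card subF; rewrite /=; lia.
(* The matrix of the [copy_vector (A i) (e j)] factors through the monomials, so its rank is at most
   [#|M|]; being triangular with nonzero diagonal, it has rank [k]. *)
pose P := \matrix_(i < k, l < #|M|) coef_monomial (A i) (enum_val l).
pose Q := \matrix_(l < #|M|, j < k) dual_vector (e j) (enum_val l).
have PQ i j : (P *m Q) i j = copy_vector (A i) (e j).
  have [_ degA _ _] := copyA i; have [] := copyA j; rewrite mem_Kedges => dege _ _ _.
  rewrite (copy_vector_expand degA dege) mxE [RHS]big_enum_val.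
  by apply: eq_bigr => l _; rewrite !mxE.
have PQ_unit : P *m Q \in unitmx.
  rewrite unitmxE det_trig ?unitfE.
    by apply/prodf_neq0 => i _; rewrite PQ copy_vector_neq0; have [] := copyA i.
  apply/is_trig_mxP => i j ltij; have [_ _ _ /(_ j ltij)] := copyA i.
  by rewrite PQ -copy_vector_neq0 negbK => /eqP.
by rewrite -(mxrank_unit PQ_unit) mulmx_max_rank.
Qed.

(** * Tightness *)

Lemma card_deg_ge (d : nat) (n c k : vec d) :
  #|[set W : {set Kvert n} |
      (deg W == k) && [forall x in W, c (tag x) <= tagged x]%N]| =
  (\prod_(i < d) 'C(n i - c i, k i))%N.
Proof.
rewrite (card_deg (fun x : Kvert n => c (tag x) <= tagged x)%N).
apply: eq_bigr => i _; rewrite -(card_color_range (c i) (leqnn (n i))).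
by congr 'C(_, _); apply: eq_card => x; rewrite !inE; case: eqP => //= <-; rewrite ltn_ord andbT.
Qed.

Lemma card_Kedges (d : nat) (S : {fset vec d}) (n : vec d) :
  #|Kedges S n| = (\sum_(s <- S) \prod_(i < d) 'C(n i, s i))%N.
Proof.
transitivity #|[set W : {set Kvert n} | (deg W \in S) &&
    [forall x in W, [ffun=> 0%N] (tag x) <= tagged x]%N]|.
  apply: eq_card => W; rewrite mem_Kedges inE; case: (_ \in _) => //=.
  by apply/esym/forall_inP => x _; rewrite ffunE.
rewrite card_fiber_sum; apply: eq_bigr => s _; rewrite card_deg_ge.
by apply: eq_bigr => i _; rewrite ffunE subn0.
Qed.

Definition vrange (d : nat) (n a b : vec d) : {set Kvert n} :=
  [set x : Kvert n | a (tag x) <= tagged x < b (tag x)]%N.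

Lemma deg_setU_vrange (d : nat) (n a b : vec d) (Y : {set Kvert n}) :
  [disjoint Y & vrange n a b]%B -> (forall i, b i <= n i)%N ->
  forall i, deg (Y :|: vrange n a b) i = (deg Y i + (b i - a i))%N.
Proof.
move=> disjY le_bn i; rewrite -(card_color_range (a i) (le_bn i)) !ffunE.
rewrite -cardsUI [X in (_ + X)%N]eq_card0 ?addn0.
  by apply: eq_card => x; rewrite !inE andb_orl; case: eqP => [<-|]; rewrite ?andbT ?andbF.
move=> x; rewrite !inE; apply/negP => /andP[/andP[xY /eqP<-] /andP[_ xab]].
by have /negP := disjointFr disjY xY; apply; rewrite inE.
Qed.

Lemma sum_box (d : nat) (s : vec d) (F : 'I_d -> nat -> nat) :
  (\sum_(m <- box s) \prod_i F i (m i) = \prod_i \sum_(j < (s i).+1) F i j)%N.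
Proof.
pose J := 'I_(\max_i s i).+1; pose Q i := [pred j : J | j <= s i]%N.
pose h (f : {ffun 'I_d -> J}) : vec d := [ffun i => nat_of_ord (f i)].
have h_inj : injective h.
  by move=> f g /ffunP eqh; apply/ffunP => i; apply/val_inj; have := eqh i; rewrite !ffunE.
have -> : box s = [fset h f | f in family Q].
  apply/fsetP => m; apply/in_box/imfsetP => /= [le_ms|[f /familyP fQ ->] i]; last first.
    by rewrite ffunE; exact: fQ.
  have ltm i : (m i < (\max_i s i).+1)%N by rewrite ltnS (leq_trans (le_ms i)) ?leq_bigmax.
  exists [ffun i => Ordinal (ltm i)]; last by apply/ffunP => i; rewrite !ffunE.
  by apply/familyP => i; rewrite ffunE; apply: le_ms.
rewrite big_imfset /= => [|f g _ _]; last exact: h_inj.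
rewrite big_enum; transitivity (\prod_i \sum_(j : J | Q i j) F i j)%N; last first.
  apply: eq_bigr => i _; have le_i : ((s i).+1 <= (\max_i s i).+1)%N by rewrite ltnS leq_bigmax.
  by rewrite (big_ord_widen _ (F i) le_i).
rewrite bigA_distr_big_dep; apply: eq_bigr => f _; apply: eq_bigr => i _.
by rewrite ffunE.
Qed.

(** The maximum turns the down-closure into a box, over which the sum factors by color;
    [sum_mchoose] evaluates each factor. *)
Lemma nmon_box (d : nat) (n t s0 : vec d) (S : {fset vec d}) : s0 \in S ->
  (forall (s : vec d) i, s \in S -> s i <= s0 i)%N ->
  nmon n S t = (\prod_(i < d) 'C(n i - t i + s0 i, s0 i))%N.
Proof.
move=> s0S le_s0; rewrite /nmon; have -> : downset S = box s0.
  apply/fsetP => m; apply/idP/in_box => [/in_downset[s /le_s0 le_s le_m] i|le_m].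
    exact: leq_trans (le_s i).
  by apply/in_downset; exists s0.
rewrite (sum_box s0 (fun i => mchoose (n i - t i))).
by apply: eq_bigr => i _; rewrite sum_mchoose.
Qed.

Lemma sum_color (d : nat) (n : vec d) (X : {set Kvert n}) (c : vec d) :
  (\sum_(x in X) c (tag x) = \sum_i deg X i * c i)%N.
Proof.
rewrite (partition_big (fun x => tag x) predT) //=; apply: eq_bigr => i _.
rewrite (eq_bigr (fun=> c i)) => [|x /andP[_ /eqP->]] //.
by rewrite sum_nat_cond_const ffunE.
Qed.

(** In each color, [e' :\: e] and [e :\: e'] have equally many vertices, so the thresholds [c] have
    the same sum over both, and this sum separates the two sums of positions. *)
Lemma sum_exchange_lt (d : nat) (n c : vec d) (e e' : {set Kvert n}) :
  deg e' = deg e -> e' != e ->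
  (forall x, x \in e :\: e' -> c (tag x) <= tagged x)%N ->
  (forall x, x \in e' :\: e -> tagged x < c (tag x))%N ->
  (\sum_(x in e') tagged x < \sum_(x in e) tagged x)%N.
Proof.
move=> eq_deg ne high low.
have degD (X Y : {set Kvert n}) i : (deg (X :&: Y) i + deg (X :\: Y) i = deg X i)%N.
  rewrite !ffunE -[RHS](cardsID Y); congr (_ + _)%N; apply: eq_card => x; rewrite !inE;
  by case: (x \in X); case: (x \in Y); rewrite ?andbF ?andbT.
have eq_degD i : deg (e' :\: e) i = deg (e :\: e') i.
  have := degD e e' i; have := degD e' e i; rewrite eq_deg setIC; lia.
rewrite (big_setID e) [ltnRHS](big_setID e') /= setIC ltn_add2l.
have [x xD] : exists x, x \in e' :\: e.
  apply/set0Pn; apply: contra ne; rewrite setD_eq0 => sub.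
  by rewrite eqEcard sub -!sum_deg eq_deg /=.
apply: (@leq_trans (\sum_(x in e' :\: e) c (tag x))%N).
  rewrite (bigD1 x) //= [leqRHS](bigD1 x) //= -addSn leq_add ?low //.
  by apply: leq_sum => y /andP[/low/ltnW].
rewrite sum_color; under eq_bigr do rewrite eq_degD.
by rewrite -sum_color; apply: leq_sum => y /high.
Qed.

Lemma removable_edges_max (d : nat) (n : vec d) (S R : {fset vec d})
    (s0 : vec d) :
  s0 \in S -> (forall (s : vec d) i, s \in S -> s i <= s0 i)%N ->
  (forall i, s0 i <= n i)%N -> (forall r : vec d, r \in R -> forall i, s0 i <= r i)%N ->
  exists D : {set {set Kvert n}}, [/\ D \subset Kedges S n, #|D|%:Z = q n S R &
    @weakly_saturated d (Khyp S n) (Kfamily S R) (Kedges S n :\: D)].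
Proof.
move=> s0S le_s0 le_n le_r.
pose c (r : vec d) : vec d := [ffun i => r i - s0 i]%N.
pose B r := [set e : {set Kvert n} |
  (deg e == s0) && [forall x in e, c r (tag x) <= tagged x]%N].
pose D := [set e | [exists r : restr R n, e \in B (val r)]].
have subD : D \subset Kedges S n.
  apply/subsetP => e; rewrite inE => /existsP[r]; rewrite inE mem_Kedges.
  by case/andP=> /eqP->.
exists D; split=> //.
  rewrite q_mchoose inclusion_exclusion big_seq_cond [RHS]big_seq_cond.
  apply: eq_bigr => Q /andP[QR Q0]; congr (_ * _%:Z).
  rewrite (nmon_box _ _ s0S le_s0).
  (* The condition [r i - s0 i <= x] reads [r i <= s0 i + x], so imposing it for all [r] in [Q] is
     imposing it for their maximum. *)
  transitivity #|B (vmax Q)|.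
    have [r0 r0Q] := fset0Pn _ Q0; apply: eq_card => e; rewrite !inE.
    apply/forallP/andP => [eQ|[dege /forall_inP hi] r].
      have := eQ [` r0Q]; rewrite inE => /andP[dege _]; split=> //.
      apply/forall_inP => x xe; rewrite ffunE leq_subLR; apply/vmax_leP => r rQ.
      have := eQ [` rQ]; rewrite inE => /andP[_ /forall_inP/(_ x xe)].
      by rewrite ffunE leq_subLR.
    rewrite inE dege; apply/forall_inP => x /hi; rewrite ![c _ _]ffunE !leq_subLR.
    by move=> /vmax_leP; apply; exact: valP.
  rewrite card_deg_ge; apply: eq_bigr => i _; congr 'C(_, _).
  have [r0 r0Q] := fset0Pn _ Q0; have := vmax_restr i QR; rewrite [c _ _]ffunE.
  have /vmax_leP/(_ r0 r0Q) := leqnn (vmax Q i).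
  have /le_r/(_ i) : r0 \in R.
    by move: QR; rewrite fpowersetE => /fsubsetP/(_ _ r0Q); rewrite !inE => /andP[].
  by have := le_n i; lia.
apply: (weakly_saturated_setD (p := fun e => \sum_(x in e) tagged x)%N) => // e.
rewrite inE => /existsP[r]; rewrite inE => /andP[/eqP dege /forall_inP high].
have := valP r; rewrite !inE => /andP[rR /forallP le_rn].
(* The copy adds to [e] the first [r i - s0 i] vertices of each color [i], which precede those of
   [e]. Another removed edge inside it trades vertices of [e] for some of these, which lowers the
   sum. *)
exists (e :|: vrange n [ffun=> 0%N] (c (val r))); split.
- suff -> : deg (e :|: vrange n [ffun=> 0%N] (c (val r))) = val r by [].
  apply/ffunP => i; rewrite deg_setU_vrange => [||j].
  + by rewrite dege !ffunE subn0 subnKC // le_r.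
  + rewrite disjoint_subset; apply/subsetP => x /high lex.
    by rewrite !inE ltnNge lex andbF.
  + by rewrite ffunE (leq_trans (leq_subr _ _)).
- exact: subsetUl.
move=> e' De' /subsetP e'A ne; apply: (sum_exchange_lt (c := c (val r))) => //.
- move: De'; rewrite inE => /existsP[r']; rewrite inE => /andP[/eqP-> _].
  by rewrite dege.
- by move=> x /finset.setDP[/high].
by move=> x /finset.setDP[/e'A]; rewrite !inE => /orP[->//|/andP[]].
Qed.

Lemma removable_edges_min (d : nat) (n : vec d) (S R : {fset vec d})
    (r0 : vec d) :
  r0 \in R -> (forall i, r0 i <= n i)%N ->
  (forall s : vec d, s \in S -> forall i, s i <= r0 i)%N ->
  exists D : {set {set Kvert n}}, [/\ D \subset Kedges S n, #|D| = nmon n S r0 &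
    @weakly_saturated d (Khyp S n) (Kfamily S R) (Kedges S n :\: D)].
Proof.
move=> r0R le_r0n le_sr0.
(* Positions start at 0: [Y] lies strictly after position [r0 i - m i], and the range below
   [below Y] stops just before it. This vacant position gives the contradiction in [block_sub]; the
   threshold gives the count through [mchoose_sub]. *)
pose c (m : vec d) : vec d := [ffun i => (r0 i).+1 - m i]%N.
pose T := [set Y : {set Kvert n} | (deg Y \in downset S) &&
  [forall x in Y, c (deg Y) (tag x) <= tagged x]%N].
have card_T : #|T| = nmon n S r0.
  rewrite card_fiber_sum; apply: eq_big_seq => m /in_downset[s sS le_ms].
  rewrite (eq_card (B := mem [set Y : {set Kvert n} | (deg Y == m) &&
    [forall x in Y, c m (tag x) <= tagged x]%N])) => [|Y]; last first.
    by rewrite !inE; case: eqP => // ->.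
  rewrite card_deg_ge; apply: eq_bigr => i _; rewrite ffunE.
  by rewrite mchoose_sub // (leq_trans (le_ms i)) ?le_sr0.
have T_S (Y : {set Kvert n}) : exists s : vec d, Y \in T -> s \in S /\ forall i, (deg Y i <= s i)%N.
  (* Outside [T] the choice is free and [r0] is a dummy value. *)
  case: (boolP (Y \in T)) => [|_]; last by exists r0.
  by rewrite inE => /andP[/in_downset[s sS le_s] _]; exists s.
have {T_S}/fin_all_exists[s_of s_ofP] := T_S.
pose below (Y : {set Kvert n}) : vec d := [ffun i => r0 i - deg Y i]%N.
pose start (Y : {set Kvert n}) : vec d := [ffun i => r0 i - s_of Y i]%N.
pose edge Y := Y :|: vrange n (start Y) (below Y).
pose block Y := Y :|: vrange n [ffun=> 0%N] (below Y).
have le_below Y i : (below Y i <= n i)%N by rewrite ffunE (leq_trans (leq_subr _ _)).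
have disj Y a : Y \in T -> [disjoint Y & vrange n a (below Y)]%B.
  rewrite inE => /andP[_ /forall_inP high]; rewrite disjoint_subset.
  apply/subsetP => x /high; rewrite !inE !ffunE; lia.
have deg_le_r0 Y i : Y \in T -> (deg Y i <= r0 i)%N.
  by move=> /s_ofP[/le_sr0 le_s /(_ i) le_d]; apply: leq_trans (le_s i).
have deg_edge Y : Y \in T -> deg (edge Y) = s_of Y.
  move=> YT; have [sS le_s] := s_ofP Y YT; apply/ffunP => i.
  rewrite deg_setU_vrange ?disj // [below _ _]ffunE [start _ _]ffunE.
  have arith k s r : (k <= s)%N -> (s <= r)%N -> (k + (r - k - (r - s)) = s)%N by lia.
  by rewrite arith ?le_sr0.
have deg_block Y : Y \in T -> deg (block Y) = r0.
  move=> YT; apply/ffunP => i; rewrite deg_setU_vrange ?disj //.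
  by rewrite [below _ _]ffunE [[ffun=> 0%N] _]ffunE subn0 subnKC ?deg_le_r0.
have block_sub Y Y' : Y \in T -> Y' \in T -> Y' \subset block Y -> Y' \subset Y.
  move=> YT Y'T sub'; have /[!inE]/andP[_ /forall_inP high'] := Y'T.
  have le_deg i : (deg Y' i <= deg Y i)%N.
    (* In color [i], at most [deg Y i + (deg Y' i - deg Y i - 1)] vertices of [block Y] are in [Y]
       or past the threshold of [Y']: one too few to hold [Y']. *)
    rewrite leqNgt; apply/negP => lt_deg.
    have /(deg_le i) : Y' \subset Y :|: vrange n (c (deg Y')) (below Y).
      apply/subsetP => x xY'; have := subsetP sub' x xY'; have := high' x xY'.
      by rewrite !inE => ->; case: (x \in Y) => //= /andP[].
    rewrite deg_setU_vrange ?disj // [below _ _]ffunE [c _ _]ffunE.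
    by have := deg_le_r0 Y' i Y'T; lia.
  (* Now the threshold of [Y'] is at least [below Y] in every color, so [Y'] misses the added
     initial range. *)
  apply/subsetP => x xY'; have := subsetP sub' x xY'; have := high' x xY'.
  rewrite !inE [c _ _]ffunE [below _ _]ffunE; case: (x \in Y) => //= lex.
  by case/andP=> _ /(leq_ltn_trans lex); rewrite ltnNge leq_sub ?le_deg.
have edge_block Y : edge Y \subset block Y.
  by apply: setUS; apply/subsetP => x; rewrite !inE => /andP[_ ->]; rewrite ffunE.
have sub_edge Y Y' : Y \in T -> Y' \in T -> edge Y' \subset block Y -> Y' \subset Y.
  by move=> YT Y'T /(subset_trans (subsetUl _ _))/(block_sub _ _ YT Y'T).
have edge_inj : {in T &, injective edge}.
  move=> Y Y' YT Y'T eqe; apply/eqP; rewrite eqEsubset; apply/andP; split.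
    by apply: (sub_edge Y' Y Y'T YT); rewrite eqe edge_block.
  by apply: (sub_edge Y Y' YT Y'T); rewrite -eqe edge_block.
(* The rank reads [#|Y|] off [edge Y]: by injectivity the sum has a single term there. *)
pose p e := (\sum_(Y in T | edge Y == e) #|Y|)%N.
have pE Y : Y \in T -> p (edge Y) = #|Y|.
  move=> YT; rewrite /p (big_pred1 Y) // => Y' /=.
  apply/andP/eqP => [[Y'T /eqP]|->]; last by rewrite YT eqxx.
  exact: edge_inj.
exists (edge @: T); split.
- apply/subsetP => _ /imsetP[Y YT ->]; rewrite mem_Kedges deg_edge //.
  by have [] := s_ofP Y YT.
- by rewrite card_in_imset.
apply: (weakly_saturated_setD (p := p)) => [|_ /imsetP[Y YT ->]].
  apply/subsetP => _ /imsetP[Y YT ->]; rewrite mem_Kedges deg_edge //.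
  by have [] := s_ofP Y YT.
(* Any other removed edge inside [block Y] comes from a proper subset of [Y]. *)
exists (block Y); split; rewrite ?deg_block //.
move=> _ /imsetP[Y' Y'T ->] sub ne; rewrite !pE //; apply: proper_card.
rewrite properEneq sub_edge // andbT; by apply: contraNneq ne => ->.
Qed.

Theorem theorem2p1 (d : nat) (d_ge1 : (1 <= d)%N) (n : vec d)
    (S R : {fset vec d}) (S_neq0 : S != fset0) (R_neq0 : R != fset0)
    (le_s : forall (s r : vec d) (i : 'I_d), s \in S -> r \in R ->
      (s i <= n i)%N /\ (s i <= r i)%N) :
  let bound : int :=
    \sum_(s <- S) (\prod_(i < d) 'C(n i, s i))%N%:Z - q n S R in
  bound <= (cwsat (Khyp S n) (Kfamily S R))%:Z /\
  ((exists2 r0 : vec d, r0 \in R &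
      forall (r : vec d) (i : 'I_d), r \in R -> (r0 i <= r i)%N) \/
   (exists2 s0 : vec d, s0 \in S &
      forall (s : vec d) (i : 'I_d), s \in S -> (s i <= s0 i)%N) ->
   (cwsat (Khyp S n) (Kfamily S R))%:Z = bound).
Proof.
have [r1 r1R] := fset0Pn _ R_neq0.
have le_sn s i : s \in S -> (s i <= n i)%N by move=> sS; have [] := le_s s r1 i sS r1R.
move=> bound.
have boundE : bound = #|Kedges S n|%:Z - #|exponents_union n S R|%:Z.
  by rewrite /bound q_card // card_Kedges (big_morph Posz PoszD (erefl _)).
have lower : bound <= (cwsat (Khyp S n) (Kfamily S R))%:Z.
  have [F satF <-] := cwsat_attained (Khyp S n) (Kfamily S R).
  by rewrite boundE lerBlDr -PoszD lez_nat; apply: weakly_saturated_card.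
split=> // extremal.
(* Given the lower bound, it is enough to remove at least as many edges as there are counted
   monomials. *)
suff [D [subD cardD satD]] : exists D : {set {set Kvert n}},
    [/\ D \subset Kedges S n, (#|exponents_union n S R| <= #|D|)%N &
      @weakly_saturated d (Khyp S n) (Kfamily S R) (Kedges S n :\: D)].
  apply/eqP; rewrite eq_le lower andbT boundE lerBrDr -PoszD lez_nat.
  apply: leq_trans (leq_add (cwsat_le satD) cardD) _.
  by rewrite /= cardsD (setIidPr subD) subnK ?subset_leq_card.
case: extremal => [[r0 r0R min_r0]|[s0 s0S max_s0]]; last first.
  have [||D [subD cardD satD]] := removable_edges_max (n := n) (R := R) s0S max_s0.
  - by move=> i; apply: le_sn.
  - by move=> r rR i; have [] := le_s s0 r i s0S rR.
  by exists D; split=> //; rewrite -lez_nat cardD q_card.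
(* If [r0] exceeds [n] in some color, so does every member of [R]: no monomial is counted, and
   nothing has to be removed. *)
have [le_r0n|] := boolP [forall i, r0 i <= n i]%N; last first.
  rewrite negb_forall => /existsP[i lt_r0]; exists finset.set0; split.
  - exact: sub0set.
  - rewrite cards0 leqn0 cards_eq0; apply/eqP/setP => k; rewrite !inE.
    apply/negbTE/negP => /existsP[r _]; have := valP r; rewrite !inE.
    by case/andP=> rR /forallP/(_ i)/(leq_trans (min_r0 _ i rR)); apply/negP.
  rewrite setD0; exact: (@weakly_saturated_edges d (Khyp S n)).
move/forallP in le_r0n.
have [|D [subD cardD satD]] := removable_edges_min (S := S) r0R le_r0n.
  by move=> s sS i; have [] := le_s s r0 i sS r0R.
(* Every [r] in [R] is at least [r0] and so allows no further coefficients: the union lies in the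
   set for [r0]. *)
exists D; split=> //; rewrite cardD -card_exponents //; apply/subset_leq_card/subsetP => k.
rewrite !inE => /existsP[r]; rewrite inE => /andP[-> /forallP supp] /=.
apply/forallP => i; apply/forallP => j; apply/implyP.
have /forallP/(_ j)/implyP suppj := supp i; move=> /suppj.
by have := valP r; rewrite !inE => /andP[rR _]; have := min_r0 _ i rR; rewrite /=; lia.
Qed.
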